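(* The moduli space $\mathcal A_n^{trop}$ of principally polarized tropical abelian varieties of dimension $n$ is equal to the locally symmetric space $\mathrm{GL}(n,\mathbb Z)\backslash \mathrm{GL}(n,\mathbb R)/\mathrm{O}(n)$: $$\mathcal A_n^{trop}\cong \mathrm{GL}(n,\mathbb Z)\backslash \mathrm{GL}(n,\mathbb R)/\mathrm{O}(n),$$ and $\dim\mathcal A_n^{trop}=\frac{n(n+1)}2$.
   Context: A tropical torus of dimension $n$ is a real torus $X=\Lambda\backslash V$, where $V$ is an $n$-dimensional real vector space and $\Lambda\subset V$ a lattice, together with a second lattice $L\subset V$ (no relation with $\Lambda$ is assumed) which determines an integral ($\mathbb Z$-affine) structure on $V$ and on $X$. Put $L^*=\mathrm{Hom}(L,\mathbb Z)\subset V^*$. Let $\mathcal O^*$ be the sheaf on $X$ of functions that are locally affine linear with integral slope (linear part in $L^*$), and $\mathbb T^*_{\mathbb Z}=\mathcal O^*/\mathbb R$, which is the constant sheaf $L^*$. A tropical line bundle on $X$ is a class in $H^1(X,\mathcal O^* )$, and its Chern class is its image in $H^1(X,\mathbb T_{\mathbb Z}^* )\cong\mathrm{Hom}(\Lambda,L^* )$. The Chern class $c:\Lambda\to L^*$ extends linearly to $V\to V^*$, i.e. defines a bilinear form $Q$ on $V$ with $Q(\lambda,v)=c(\lambda)(v)$; this form is symmetric, and conversely every symmetric bilinear form on $V$ mapping $\Lambda$ into $L^*$ arises in this way. A polarized tropical abelian variety is a tropical torus with a tropical line bundle whose form $Q$ is positive definite; the polarization is principal if the index of $c(\Lambda)$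 in $L^*$ is 1, i.e. $c(\Lambda)=L^*$. Two principally polarized tropical abelian varieties $(V,\Lambda,L,Q)$ and $(V',\Lambda',L',Q')$ are isomorphic if there is a linear isomorphism $V\to V'$ carrying $\Lambda,L,Q$ to $\Lambda',L',Q'$; $\mathcal A_n^{trop}$ is the set of isomorphism classes in dimension $n$. $\mathrm{GL}(n,\mathbb R)/\mathrm{O}(n)$ is identified with the space of positive definite symmetric $n\times n$ matrices, with $g\cdot A=gAg^t$. The identification $\cong$ is the natural one, which sends the class of $(V,\Lambda,L,Q)$ to the $\mathrm{GL}(n,\mathbb Z)$-orbit of the Gram matrix of $Q$ in a $\mathbb Z$-basis of $\Lambda$. *)

(* Defs.v *)
From HB Require Import structures.
From mathcomp Require Import all_boot all_order all_algebra.
From mathcomp Require Import all_classical all_reals topology normedtype.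

Set Implicit Arguments.
Unset Strict Implicit.
Unset Printing Implicit Defensive.

Import Order.TTheory GRing.Theory Num.Theory.
Import numFieldNormedType.Exports.
Local Open Scope classical_set_scope.
Local Open Scope ring_scope.
Local Open Scope quotient_scope.

Definition zbasis (R : realType) (V : vectType R) (n : nat)
    (A : set V) (b : n.-tuple V) : Prop :=
  basis_of fullv b /\ A = [set v | inIntSpan b v].

Definition lattice (R : realType) (V : vectType R) (A : set V) : Prop :=
  exists b : (\dim {:V}).-tuple V, zbasis A b.

(* Hom(L, Z), as the linear forms on V that take integer values on L. *)
Definition dual_lattice (R : realType) (V : vectType R) (L : set V) :
    set (V -> R) :=
  [set f | scalar f /\ forall v, L v -> f v \is a Num.int].

(* The torus is periods \ space; affine_lattice is the lattice L of its integral
   affine structure. *)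
Record tropical_torus (R : realType) (n : nat) := TropicalTorus {
  space :> vectType R;
  dim_space : \dim {:space} = n;
  periods : set space;
  affine_lattice : set space;
  periodsP : lattice periods;
  affine_latticeP : lattice affine_lattice }.

Arguments periods {R n} t _.
Arguments affine_lattice {R n} t _.

(* c : V -> V^*, extending the Chern class Lambda -> L^*. *)
Definition chern (R : realType) (V : vectType R) (Q : V -> V -> R) :
  V -> (V -> R) := fun u => Q u.

Definition symmetric_bilinear (R : realType) (V : vectType R)
    (Q : V -> V -> R) : Prop :=
  (forall u, scalar (Q u)) /\ (forall u v, Q u v = Q v u).

(* The line bundle enters only through its form: tropical line bundles with
   form Q exist on X exactly when Q is symmetric and c(Lambda) is contained in
   L^*, and isomorphism of principally polarized varieties only sees Q. *)
Record polarized_tav (R : realType) (n : nat) := PolarizedTAV {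
  torus :> tropical_torus R n;
  pol_form : torus -> torus -> R;
  pol_form_bilinear : symmetric_bilinear pol_form;
  pol_form_chern :
    chern pol_form @` periods torus `<=` dual_lattice (affine_lattice torus);
  pol_form_posdef : forall v : torus, v != 0 -> 0 < pol_form v v }.

Arguments pol_form {R n} p.

Record pptav (R : realType) (n : nat) := PPTAV {
  polarized :> polarized_tav R n;
  principal : chern (pol_form polarized) @` periods polarized
              = dual_lattice (affine_lattice polarized) }.

Definition pptav_iso (R : realType) (n : nat) (X Y : pptav R n) : Prop :=
  exists f : {linear X -> Y},
    [/\ bijective f,
        f @` periods X = periods Y,
        f @` affine_lattice X = affine_lattice Y &
        forall u v : X, pol_form Y (f u) (f v) = pol_form X u v].

(* A_n^trop, an isomorphism class being the predicate of membership in it.  The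
   type of tori is too large (in the sense of universes) to be a choiceType, so
   neither quotType nor topologicalType applies to it. *)
Definition trop_moduli (R : realType) (n : nat) : Type :=
  {C : pptav R n -> Prop | exists X, C = pptav_iso X}.

Definition tav_class (R : realType) (n : nat) (X : pptav R n) :
    trop_moduli R n :=
  exist _ (pptav_iso X) (ex_intro _ X erefl).

Definition gram (R : realType) (V : vectType R) (Q : V -> V -> R) (n : nat)
    (b : n.-tuple V) : 'M[R]_n :=
  \matrix_(i, j) Q (tnth b i) (tnth b j).

Definition GLn (R : realType) (n : nat) : set 'M[R]_n :=
  [set g | g \in unitmx].

Definition On (R : realType) (n : nat) : set 'M[R]_n :=
  [set k | k *m k^T = 1%:M].

Definition GLnZ (R : realType) (n : nat) : set 'M[R]_n :=
  [set map_mx intr z | z in [set z : 'M[int]_n | z \in unitmx]].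

Arguments GLn : clear implicits.
Arguments On : clear implicits.
Arguments GLnZ : clear implicits.

Definition dcoset (R : realType) (n : nat) : rel (GLn R n) := fun g h =>
  `[< exists z k, [/\ GLnZ R n z, On R n k & \val h = z *m \val g *m k] >].

Lemma dcoset_equiv (R : realType) (n : nat) : equiv_class_of (@dcoset R n).
Proof.
have refl : reflexive (@dcoset R n).
  move=> g; apply/asboolP; exists 1%:M, 1%:M; split.
  - by exists 1%:M; [exact: unitmx1 | rewrite map_mx1].
  - by rewrite /On/= mul1mx trmx1.
  - by rewrite mul1mx mulmx1.
have sym (g h : GLn R n) : dcoset g h -> dcoset h g.
  move=> /asboolP[_ [k [[z zU <-] kO hE]]]; apply/asboolP.
  exists (map_mx intr (invmx z)), k^T; split.
  - by exists (invmx z); rewrite //= unitmx_inv.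
  - by rewrite /On/= trmxK; exact: mulmx1C.
  - by rewrite hE !mulmxA -map_mxM mulVmx// map_mx1 mul1mx -mulmxA kO mulmx1.
have trans (h g i : GLn R n) : dcoset g h -> dcoset h i -> dcoset g i.
  move=> /asboolP[_ [k [[z zU <-] kO hE]]] /asboolP[_ [l [[w wU <-] lO iE]]].
  apply/asboolP; exists (map_mx intr (w *m z)), (k *m l); split.
  - by exists (w *m z); rewrite //= unitmx_mul wU.
  - by rewrite /On/= trmx_mul mulmxA -(mulmxA k) lO mulmx1.
  - by rewrite iE hE map_mxM !mulmxA.
split; [exact: refl | move=> g h | exact: trans].
by apply/idP/idP; exact: sym.
Qed.

Canonical dcoset_equivrel (R : realType) (n : nat) :=
  EquivRelPack (dcoset_equiv R n).

(* GL(n,Z) \ GL(n,R) / O(n) with the quotient topology. *)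
Definition locsym (R : realType) (n : nat) : topologicalType :=
  quotient_topology {eq_quot dcoset_equivrel R n}.

Definition locsym_class (R : realType) (n : nat) (g : GLn R n) : locsym R n :=
  \pi_(quotient_topology {eq_quot dcoset_equivrel R n}) g.

Definition finite_linear_group (R : realType) (d : nat) (G : set 'M[R]_d) :
    Prop :=
  [/\ finite_set G, G `<=` GLn R d, G 1%:M &
      forall g h, G g -> G h -> G (g *m h)].

(* p induces a homeomorphism from U / G onto an open neighbourhood of x, where T
   has the topology whose open sets are those satisfying opn.  T -> Prop is not
   written set T, for the universe reason given at trop_moduli. *)
Definition orbifold_chart (R : realType) (T : Type) (opn : (T -> Prop) -> Prop)
    (d : nat) (x : T) (G : set 'M[R]_d) (U : set 'rV[R]_d)
    (p : 'rV[R]_d -> T) : Prop :=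
  [/\ finite_linear_group G,
      open U /\ (forall u g, U u -> G g -> U (u *m g)),
      exists2 u, U u & p u = x,
      (forall A, opn A -> open [set u | U u /\ A (p u)]) /\
        (forall W, open W -> W `<=` U ->
           opn (fun y => exists2 u, W u & p u = y)) &
      forall u v, U u -> U v ->
        (p u = p v <-> exists2 g, G g & v = u *m g)].

(* The quotient of a manifold by a properly discontinuous action is an orbifold
   (some points of A_n^trop have nontrivial isotropy), and its dimension is
   that of its charts.  A finite group of diffeomorphisms fixing a point is
   linear in suitable coordinates near it, so only linear groups are allowed
   in charts.  Groups in charts act faithfully, so T has a nonempty open subset
   homeomorphic to an open subset of R^d, and d is unique. *)
Definition orbifold_dim (R : realType) (T : Type) (opn : (T -> Prop) -> Prop)
    (d : nat) : Prop :=
  inhabited T /\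
  forall x : T, exists G U p, @orbifold_chart R T opn d x G U p.

(* The open sets of A that correspond to those of B under f : A -> B. *)
Definition pullback_open (A : Type) (B : topologicalType) (f : A -> B) :
    (A -> Prop) -> Prop :=
  fun S => exists2 O : set B, open O & S = (fun x => O (f x)).

(* Main.v *)
From HB Require Import structures.
Require Import Defs.
From mathcomp Require Import all_boot all_order all_algebra.
From mathcomp Require Import all_classical all_reals topology normedtype.
From mathcomp Require Import realfun ring lra zify.

Set Implicit Arguments.
Unset Strict Implicit.
Unset Printing Implicit Defensive.

Import Order.TTheory GRing.Theory Num.Theory.
Import numFieldNormedType.Exports.
Local Open Scope classical_set_scope.
Local Open Scope ring_scope.

(** A principally polarized tropical abelian variety is determined up to
    isomorphism by the quadratic form Q on the period lattice Lambda.  Indeed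
    the integral lattice L is its own double dual, and principality says that
    its dual is c(Lambda), so L is the set of v with Q(u, v) integral for all u
    in Lambda ([affine_latticeE]).  Changing the basis of Lambda by an integral
    invertible z replaces the Gram matrix A by z A z^T, so that isomorphism
    classes correspond to GL(n,Z)-orbits of Gram matrices ([pptav_isoP]); every
    positive definite A occurs, on R^n with the periods Z^n ([pptav_of_gram]).
    On the other side, g g^T = h h^T exactly when h = g k with k orthogonal, so
    the same orbits are the double cosets ([gram_class_eq]), once each positive
    definite A is known to have the form g g^T.  The Cholesky factorization
    gives such a g, and gives it as a continuous function of A
    ([cvg_cholesky]); hence a map into the double coset space may be checked to
    be continuous on Gram matrices.

    For the dimension, fix g and write the symmetric matrices near g g^T as
    g (1 + T) g^T, where T has n(n+1)/2 free entries.  In this parameter an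
    integral z acts through w = g^-1 z g: it fixes the centre exactly when w is
    orthogonal, and then T goes to w T w^T, which is linear and preserves the
    Frobenius norm.  Balls are therefore invariant under the stabilizer of the
    centre.  If z moves a point of the ball of radius 1/2 to another one, then
    the entries of w are at most 2 in absolute value ([entry_near_orthogonal]),
    so there are finitely many such z; those that do not fix the centre are
    excluded by shrinking the ball ([gap_nonorthogonal], [chart_radius]).  On
    the smaller ball two points have the same class exactly when the finite
    stabilizer relates them, which is an orbifold chart ([locsym_chart]). *)

(** * Positive definite matrices *)

Definition qform (R : realType) (n : nat) (A : 'M[R]_n) (x : 'rV[R]_n) : R :=
  (x *m A *m x^T) 0 0.

Definition posdef (R : realType) (n : nat) (A : 'M[R]_n) : Prop :=
  A^T = A /\ forall x, x != 0 -> 0 < qform A x.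

Section PosDef.
Variables (R : realType).
Implicit Types n : nat.

Lemma posdef_unit n (A : 'M[R]_n) : posdef A -> A \in unitmx.
Proof.
move=> [_ Apos]; rewrite -row_free_unit; apply: inj_row_free => v vA0.
apply: contraTeq isT => /Apos.
by rewrite /qform vA0 mul0mx mxE ltxx.
Qed.

Lemma posdef1 n : posdef (1%:M : 'M[R]_n).
Proof.
split; first exact: trmx1.
move=> x x0; rewrite /qform mulmx1 mxE.
have sq_ge0 (i : 'I_n) : true -> 0 <= x 0 i * x^T i 0.
  by move=> _; rewrite mxE -expr2 sqr_ge0.
rewrite lt_neqAle sumr_ge0 // andbT eq_sym.
apply: contraNneq x0 => /(psumr_eq0P sq_ge0) x0.
apply/eqP/rowP => i; apply/eqP.
by have /eqP := x0 i isT; rewrite !mxE mulf_eq0 orbb.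
Qed.

Lemma posdef_congr n (h A : 'M[R]_n) :
  h \in unitmx -> posdef A -> posdef (h *m A *m h^T).
Proof.
move=> hU [AT Apos]; split; first by rewrite !trmx_mul trmxK AT mulmxA.
move=> x x0; have := Apos (x *m h); rewrite /qform trmx_mul !mulmxA; apply.
by apply: contraNneq x0 => xh0; rewrite -(mulmxK hU x) xh0 mul0mx.
Qed.

Lemma posdef_gram n (h : 'M[R]_n) : h \in unitmx -> posdef (h *m h^T).
Proof. by move=> hU; rewrite -[h in h *m _]mulmx1; exact/posdef_congr/posdef1. Qed.

Lemma unit_of_posdef_gram n (h : 'M[R]_n) :
  posdef (h *m h^T) -> h \in unitmx.
Proof. by move=> /posdef_unit; rewrite unitmx_mul => /andP[]. Qed.

Definition schur_complement m (A : 'M[R]_(1 + m)) : 'M[R]_m :=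
  drsubmx A - (A 0 0)^-1 *: (dlsubmx A *m (dlsubmx A)^T).

Fixpoint cholesky n : 'M[R]_n -> 'M[R]_n :=
  match n with
  | 0 => id
  | m.+1 => fun A : 'M[R]_(1 + m) =>
      block_mx (Num.sqrt (A 0 0))%:M 0
        ((Num.sqrt (A 0 0))^-1 *: dlsubmx A) (cholesky (schur_complement A))
  end.

Lemma sym_block m (A : 'M[R]_(1 + m)) : A^T = A ->
  A = block_mx (A 0 0)%:M (dlsubmx A)^T (dlsubmx A) (drsubmx A).
Proof.
move=> AT; rewrite -{1}[A]submxK; congr block_mx.
- by rewrite [LHS]mx11_scalar !mxE; congr (A _ _)%:M; apply/val_inj.
- by rewrite trmx_dlsub AT.
Qed.

Lemma posdef_corner m (A : 'M[R]_(1 + m)) : posdef A -> 0 < A 0 0.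
Proof.
move=> [AT Apos].
have e0 : row_mx 1%:M 0 != 0 :> 'rV[R]_(1 + m).
  rewrite -row_mx0; apply/eqP => /eq_row_mx[/matrixP/(_ 0 0)].
  by rewrite !mxE => /eqP; rewrite oner_eq0.
have := Apos _ e0; rewrite /qform {1}(sym_block AT).
rewrite mul_row_block !mul0mx !addr0 mul1mx tr_row_mx mul_row_col trmx0 mulmx0.
by rewrite trmx1 mulmx1 addr0 !mxE eqxx.
Qed.

(** Completing the square: the value of the Schur complement at y is the value
    of A at the vector that prolongs y by the first coordinate t for which the
    form is smallest. *)
Lemma posdef_schur m (A : 'M[R]_(1 + m)) : posdef A -> posdef (schur_complement A).
Proof.
move=> Apd; have a0 := posdef_corner Apd; case: Apd => AT Apos; split.
  rewrite /schur_complement linearB linearZ /= trmx_mul trmxK.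
  by rewrite trmx_drsub AT.
move=> y y0; set b := dlsubmx A.
pose t : 'M[R]_1 := - (A 0 0)^-1 *: (y *m b).
have ty0 : row_mx t y != 0.
  by apply: contraNneq y0; rewrite -row_mx0 => /eq_row_mx[_ ->].
have := Apos _ ty0; rewrite /qform {1}(sym_block AT) -/b.
rewrite mul_row_block tr_row_mx mul_row_col.
rewrite /schur_complement -/b mulmxBr mulmxBl.
suff -> : (t *m (A 0 0)%:M + y *m b) *m t^T +
          (t *m b^T + y *m drsubmx A) *m y^T =
  y *m drsubmx A *m y^T - y *m ((A 0 0)^-1 *: (b *m b^T)) *m y^T by [].
rewrite mul_mx_scalar /t scalerA mulrN divff ?gt_eqF // scaleN1r addNr mul0mx.
rewrite add0r mulmxDl addrC; congr (_ + _).
by rewrite -scalemxAl !scaleNr mulNmx -scalemxAr -scalemxAl !mulmxA -scalemxAl.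
Qed.

Lemma choleskyP n (A : 'M[R]_n) :
  posdef A -> cholesky A *m (cholesky A)^T = A.
Proof.
elim: n A => [|m IH] A Apd; first by rewrite [LHS]flatmx0 [RHS]flatmx0.
have a0 := posdef_corner Apd; have AT := Apd.1.
have s0 : Num.sqrt (A 0 0) != 0 by rewrite gt_eqF // sqrtr_gt0.
pose L : 'M[R]_(1 + m) := block_mx (Num.sqrt (A 0 0))%:M 0
  ((Num.sqrt (A 0 0))^-1 *: dlsubmx (A : 'M_(1 + m)))
  (cholesky (schur_complement A)).
rewrite -[LHS]/(L *m L^T) [RHS](sym_block AT) /L.
rewrite tr_block_mx mulmx_block IH; last exact: posdef_schur.
rewrite trmx0 !mulmx0 !mul0mx !addr0 tr_scalar_mx.
rewrite -scalar_mxM -expr2 sqr_sqrtr ?ltW // linearZ /=.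
rewrite mul_mx_scalar mul_scalar_mx !scalerA mulfV // !scale1r.
rewrite -scalemxAl -scalemxAr scalerA -invfM -expr2 sqr_sqrtr ?ltW //.
by rewrite /schur_complement addrC subrK.
Qed.

Lemma cholesky_unit n (A : 'M[R]_n) : posdef A -> cholesky A \in unitmx.
Proof. by move=> Apd; apply: unit_of_posdef_gram; rewrite choleskyP. Qed.

End PosDef.

(** * Continuity of matrix operations *)

Section MatrixLimits.
Variables (R : realType) (T : Type) (F : set_system T).
Context {FF : Filter F}.

Lemma cvg_mxP m n (f : T -> 'M[R]_(m, n)) (M : 'M[R]_(m, n)) :
  f @ F --> M <-> forall i j, f t i j @[t --> F] --> M i j.
Proof.
split=> [fM i j A MA|fM A [P MP PA]].
  have /fM : nbhs M [set N : 'M[R]_(m, n) | A (N i j)].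
    exists (fun i' j' => if (i' == i) && (j' == j) then A else setT).
      move=> i' j'; case: ifP => [/andP[/eqP-> /eqP->]//|_]; exact: filterT.
    by move=> N /(_ i j); rewrite !eqxx.
  by [].
have : \forall t \near F, forall i j, P i j (f t i j).
  by apply: filter_forall => i; apply: filter_forall => j; exact/fM/MP.
by apply: filterS => t Pt; exact: PA.
Qed.

Lemma cvg_mulmx m n p (f : T -> 'M[R]_(m, n)) (g : T -> 'M[R]_(n, p))
    (A : 'M[R]_(m, n)) (B : 'M[R]_(n, p)) :
  f @ F --> A -> g @ F --> B -> f t *m g t @[t --> F] --> A *m B.
Proof.
move=> /cvg_mxP fA /cvg_mxP gB; apply/cvg_mxP => i j.
under eq_cvg do rewrite mxE.
by rewrite mxE; apply: cvg_big => [|k _]; [exact: add_continuous|exact: cvgM].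
Qed.

Lemma cvg_trmx m n (f : T -> 'M[R]_(m, n)) (A : 'M[R]_(m, n)) :
  f @ F --> A -> (f t)^T @[t --> F] --> A^T.
Proof.
move=> /cvg_mxP fA; apply/cvg_mxP => i j.
by under eq_cvg do rewrite mxE; rewrite mxE; exact: fA.
Qed.

Lemma cvg_block_mx m n p q (f : T -> 'M[R]_(m, n)) (g : T -> 'M[R]_(m, p))
    (h : T -> 'M[R]_(q, n)) (k : T -> 'M[R]_(q, p))
    (A : 'M[R]_(m, n)) (B : 'M[R]_(m, p))
    (C : 'M[R]_(q, n)) (D : 'M[R]_(q, p)) :
  f @ F --> A -> g @ F --> B -> h @ F --> C -> k @ F --> D ->
  block_mx (f t) (g t) (h t) (k t) @[t --> F] --> block_mx A B C D.
Proof.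
move=> /cvg_mxP fA /cvg_mxP gB /cvg_mxP hC /cvg_mxP kD; apply/cvg_mxP => i j.
case: (split_ordP i) => i' ->; case: (split_ordP j) => j' ->.
- by under eq_cvg do rewrite block_mxEul; rewrite block_mxEul; exact: fA.
- by under eq_cvg do rewrite block_mxEur; rewrite block_mxEur; exact: gB.
- by under eq_cvg do rewrite block_mxEdl; rewrite block_mxEdl; exact: hC.
- by under eq_cvg do rewrite block_mxEdr; rewrite block_mxEdr; exact: kD.
Qed.

Lemma cvg_scalemx m n (c : T -> R) (f : T -> 'M[R]_(m, n)) (a : R)
    (A : 'M[R]_(m, n)) :
  c @ F --> a -> f @ F --> A -> c t *: f t @[t --> F] --> a *: A.
Proof.
move=> ca /cvg_mxP fA; apply/cvg_mxP => i j.
by under eq_cvg do rewrite mxE; rewrite mxE; exact: cvgM.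
Qed.

Lemma cvg_addmx m n (f g : T -> 'M[R]_(m, n)) (A B : 'M[R]_(m, n)) :
  f @ F --> A -> g @ F --> B -> f t + g t @[t --> F] --> A + B.
Proof.
move=> /cvg_mxP fA /cvg_mxP gB; apply/cvg_mxP => i j.
by under eq_cvg do rewrite mxE; rewrite mxE; exact: cvgD.
Qed.

(** The recursion divides by the corner entry and by its square root only, and
    both stay away from 0 near a positive definite matrix. *)
Lemma cvg_cholesky n (f : T -> 'M[R]_n) (A : 'M[R]_n) :
  posdef A -> f @ F --> A -> cholesky (f t) @[t --> F] --> cholesky A.
Proof.
elim: n f A => [|m IH] f A Apd fA; first exact: fA.
have a0 := posdef_corner Apd; have /cvg_mxP fAij := fA.
have scvg : Num.sqrt (f t 0 0) @[t --> F] --> Num.sqrt (A 0 0).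
  exact: (cvg_comp _ _ (fAij 0 0) (@sqrt_continuous _ _)).
have dl : dlsubmx (f t : 'M_(1 + m)) @[t --> F] --> dlsubmx (A : 'M_(1 + m)).
  by apply/cvg_mxP => i j; under eq_cvg do rewrite !mxE; rewrite !mxE; exact: fAij.
have dr : drsubmx (f t : 'M_(1 + m)) @[t --> F] --> drsubmx (A : 'M_(1 + m)).
  by apply/cvg_mxP => i j; under eq_cvg do rewrite !mxE; rewrite !mxE; exact: fAij.
have sch : schur_complement (f t : 'M_(1 + m)) @[t --> F] -->
           schur_complement (A : 'M_(1 + m)).
  rewrite /schur_complement; under eq_cvg do rewrite -scaleNr.
  rewrite -scaleNr; apply: cvg_addmx => //; apply: cvg_scalemx.
    by apply: cvgN; apply: cvgV; [rewrite gt_eqF|].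
  by apply: cvg_mulmx => //; exact: cvg_trmx.
apply: (@cvg_block_mx 1 1 m m (fun t => (Num.sqrt (f t 0 0))%:M) (fun=> 0)
  (fun t => (Num.sqrt (f t 0 0))^-1 *: dlsubmx (f t : 'M_(1 + m)))
  (fun t => cholesky (schur_complement (f t : 'M_(1 + m))))).
- apply/cvg_mxP => i j; rewrite !ord1.
  under eq_cvg do rewrite mxE eqxx mulr1n.
  by rewrite mxE eqxx mulr1n; exact: scvg.
- exact: cvg_cst.
- by apply: cvg_scalemx => //; apply: cvgV; rewrite ?gt_eqF ?sqrtr_gt0.
- by apply: IH => //; exact: posdef_schur.
Qed.

End MatrixLimits.

(** * Double cosets as classes of positive definite matrices *)

Section GramClass.
Variables (R : realType) (n : nat).

Lemma unitmx_intr (z : 'M[int]_n) :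
  z \in unitmx -> (map_mx intr z : 'M[R]_n) \in unitmx.
Proof.
move=> zU; suff /mulmx1_unit[] : map_mx intr z *m map_mx intr (invmx z)
  = 1%:M :> 'M[R]_n by [].
by rewrite -map_mxM mulmxV // map_mx1.
Qed.

Lemma GLn1 : (1%:M : 'M[R]_n) \in GLn R n.
Proof. by apply/mem_set; exact: unitmx1. Qed.

Lemma GLn_unit (g : GLn R n) : \val g \in unitmx.
Proof. exact: (set_mem (valP g)). Qed.

(** The double coset of any g with g *m g^T = A.  The Cholesky factor serves
    as g because it depends continuously on A. *)
Definition gram_class (A : 'M[R]_n) : locsym R n :=
  locsym_class (insubd (SigSub GLn1 : GLn R n) (cholesky A)).

(** If h *m h^T = z *m (g *m g^T) *m z^T, then g^-1 z^-1 h is orthogonal. *)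
Lemma locsym_class_eq (g h : GLn R n) :
  locsym_class g = locsym_class h <->
  exists2 z : 'M[int]_n, z \in unitmx &
    \val h *m (\val h)^T =
    map_mx intr z *m (\val g *m (\val g)^T) *m (map_mx intr z)^T.
Proof.
split.
  move=> /(eqmodP (dcoset_equivrel R n))/asboolP[_ [k [[z zU <-] kO ->]]].
  exists z => //; rewrite !trmx_mul !mulmxA.
  by rewrite -(mulmxA _ k) (kO : k *m k^T = 1%:M) mulmx1.
move=> [z zU hE]; apply/(eqmodP (dcoset_equivrel R n))/asboolP.
have zU' := unitmx_intr zU.
have gU := GLn_unit g.
exists (map_mx intr z), (invmx (\val g) *m invmx (map_mx intr z) *m \val h).
split; first by exists z.
  rewrite /On /= !trmx_mul !mulmxA -(mulmxA _ (\val h)) hE !mulmxA.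
  rewrite mulmxKV // mulVmx // mul1mx -!mulmxA -!trmx_mul.
  by rewrite mulmxKV // mulVmx // trmx1.
by rewrite !mulmxA mulmxK // mulmxV // mul1mx.
Qed.

Lemma val_cholesky (A : 'M[R]_n) : posdef A ->
  \val (insubd (SigSub GLn1 : GLn R n) (cholesky A)) = cholesky A.
Proof. by move=> Apd; rewrite insubdK //; apply/mem_set; exact: cholesky_unit. Qed.

Lemma gram_class_eq (A B : 'M[R]_n) : posdef A -> posdef B ->
  gram_class A = gram_class B <->
  exists2 z : 'M[int]_n, z \in unitmx &
    B = map_mx intr z *m A *m (map_mx intr z)^T.
Proof.
by move=> Apd Bpd; rewrite /gram_class locsym_class_eq !val_cholesky // !choleskyP.
Qed.

Lemma gram_class_gram (g : GLn R n) :
  gram_class (\val g *m (\val g)^T) = locsym_class g.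
Proof.
have gpd := posdef_gram (GLn_unit g).
apply/locsym_class_eq; exists 1%:M; first exact: unitmx1.
by rewrite val_cholesky // choleskyP // map_mx1 trmx1 mul1mx mulmx1.
Qed.

Lemma gram_class_surj (x : locsym R n) :
  exists g : GLn R n, x = gram_class (\val g *m (\val g)^T).
Proof.
by exists (repr x); rewrite gram_class_gram /locsym_class reprK.
Qed.

End GramClass.

(** * Lattices and Gram matrices *)

Lemma intr_mx_inj (R : realType) m n :
  injective (map_mx intr : 'M[int]_(m, n) -> 'M[R]_(m, n)).
Proof.
move=> A B /matrixP AB; apply/matrixP => i j.
by have := AB i j; rewrite !mxE => /intr_inj.
Qed.

Section Lincomb.
Variables (R : realType) (V : vectType R) (n : nat).
Implicit Types (b : n.-tuple V) (x : 'rV[R]_n) (A : set V) (Q : V -> V -> R).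

Definition lincomb b x : V := \sum_(i < n) x 0 i *: tnth b i.

Lemma lincomb_is_linear b : linear (lincomb b).
Proof.
move=> a x y; rewrite /lincomb scaler_sumr -big_split /=.
by apply: eq_bigr => i _; rewrite !mxE scalerDl scalerA.
Qed.

HB.instance Definition _ b :=
  GRing.isLinear.Build R 'rV[R]_n V _ (lincomb b) (lincomb_is_linear b).

Definition mxact (M : 'M[R]_n) b : n.-tuple V :=
  [tuple lincomb b (row i M) | i < n].

Lemma lincomb_mxact M b x : lincomb (mxact M b) x = lincomb b (x *m M).
Proof.
rewrite mulmx_sum_row linear_sum /=; apply: eq_bigr => i _.
by rewrite tnth_mktuple linearZ.
Qed.

Lemma lincomb_delta b i : lincomb b (delta_mx 0 i) = tnth b i.
Proof.
rewrite /lincomb (bigD1 i) //= mxE !eqxx scale1r big1 ?addr0 // => j ji.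
by rewrite mxE (negPf ji) andbF scale0r.
Qed.

Lemma mxact1 b : mxact 1%:M b = b.
Proof. by apply: eq_from_tnth => i; rewrite tnth_mktuple row1 lincomb_delta. Qed.

Lemma basis_lincombP b : basis_of fullv b <->
  (forall v, exists x, v = lincomb b x) /\ (forall x, lincomb b x = 0 -> x = 0).
Proof.
split=> [bb|[surj inj]].
  split=> [v|x x0].
    exists (\row_i coord b i v); rewrite [LHS](coord_basis bb (memvf v)).
    by apply: eq_bigr => i _; rewrite mxE -tnth_nth.
  apply/rowP => i; rewrite mxE; move: i.
  have /freeP := basis_free bb; apply.
  by rewrite -[RHS]x0; apply: eq_bigr => i _; rewrite -tnth_nth.
apply/andP; split.
  rewrite eqEsubv subvf; apply/subvP => v _; have [x ->] := surj v.
  apply: memv_suml => i _; apply/memvZ/memv_span/mem_tnth.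
apply/freeP => k k0 i.
have /inj/rowP/(_ i) : lincomb b (\row_i k i) = 0.
  by rewrite -[RHS]k0; apply: eq_bigr => j _; rewrite mxE -tnth_nth.
by rewrite !mxE.
Qed.

Lemma lincomb_inj b : basis_of fullv b -> injective (lincomb b).
Proof.
move=> /basis_lincombP[_ inj] x y xy; apply/eqP; rewrite -subr_eq0; apply/eqP.
by apply: inj; rewrite linearB /= xy subrr.
Qed.

Lemma inIntSpanP b v :
  inIntSpan b v <-> exists a : 'rV[int]_n, v = lincomb b (map_mx intr a).
Proof.
split=> [[a ->]|[a ->]].
  exists (\row_i a i); apply: eq_bigr => i _.
  by rewrite !mxE scaler_int -tnth_nth.
exists [ffun i => a 0 i]; apply: eq_bigr => i _.
by rewrite !mxE ffunE scaler_int -tnth_nth.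
Qed.

Lemma zbasisP A b : zbasis A b <-> basis_of fullv b /\
  forall v, A v <-> exists a : 'rV[int]_n, v = lincomb b (map_mx intr a).
Proof.
split=> -[bb AE]; split=> //.
  by move=> v; rewrite AE; exact: inIntSpanP.
by apply/seteqP; split=> v /=; [move=> /AE/inIntSpanP|move=> /inIntSpanP/AE].
Qed.

Lemma zbasis_mxact A b (z : 'M[int]_n) : z \in unitmx ->
  zbasis A b -> zbasis A (mxact (map_mx intr z) b).
Proof.
move=> zU /zbasisP[bb AE]; have zU' := unitmx_intr R zU.
have [surj _] := (basis_lincombP b).1 bb.
apply/zbasisP; split.
  apply/basis_lincombP; split=> [v|x].
    have [x ->] := surj v; exists (x *m invmx (map_mx intr z)).
    by rewrite lincomb_mxact mulmxKV.
  rewrite lincomb_mxact -(linear0 (lincomb b)) => /(lincomb_inj bb) xz0.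
  by rewrite -(mulmxK zU' x) xz0 mul0mx.
move=> v; rewrite AE; split=> -[a ->].
  by exists (a *m invmx z); rewrite lincomb_mxact -map_mxM mulmxKV.
by exists (a *m z); rewrite lincomb_mxact map_mxM.
Qed.

Lemma zbasis_int_mxact A b c : zbasis A b -> zbasis A c ->
  exists z : 'M[int]_n, c = mxact (map_mx intr z) b.
Proof.
move=> /zbasisP[_ AE] /zbasisP[_ cE].
have /choice[a aE] : forall i, exists a : 'rV[int]_n,
    tnth c i = lincomb b (map_mx intr a).
  move=> i; apply/AE/cE; exists (delta_mx 0 i).
  by rewrite map_delta_mx lincomb_delta.
exists (\matrix_i a i); apply: eq_from_tnth => i.
by rewrite tnth_mktuple aE -map_row rowK.
Qed.

(** Each basis is an integral combination of the other, and the two matrices of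
    coefficients are inverse to each other since a basis is free. *)
Lemma zbasis_change A b c : zbasis A b -> zbasis A c ->
  exists2 z : 'M[int]_n, z \in unitmx & c = mxact (map_mx intr z) b.
Proof.
move=> zb zc; have [z cz] := zbasis_int_mxact zb zc.
have [w bw] := zbasis_int_mxact zc zb; exists z => //.
suff /mulmx1_unit[] : w *m z = 1%:M by [].
apply/row_matrixP => i; apply: (@intr_mx_inj R).
apply: (lincomb_inj zb.1); rewrite row_mul map_mxM map_row.
by rewrite -lincomb_mxact -cz row1 map_delta_mx lincomb_delta [in RHS]bw tnth_mktuple.
Qed.

Lemma form_lincomb Q b x y : symmetric_bilinear Q ->
  Q (lincomb b x) (lincomb b y) = (x *m gram Q b *m y^T) 0 0.
Proof.
move=> [Qlin Qsym].
have linr u (z : 'rV[R]_n) :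
    Q u (lincomb b z) = \sum_i z 0 i * Q u (tnth b i).
  pose f := GRing.isLinear.Build R V R *%R (Q u) (Qlin u).
  pose g : {scalar V} := HB.pack (Q u) f.
  rewrite -[Q u]/(g : V -> R) linear_sum; apply: eq_bigr => i _.
  by rewrite linearZ.
rewrite linr [RHS]mxE; apply: eq_bigr => j _; rewrite Qsym linr mulrC !mxE.
by congr (_ * _); apply: eq_bigr => i _; rewrite mxE Qsym.
Qed.

Lemma gram_mxact Q b M : symmetric_bilinear Q ->
  gram Q (mxact M b) = M *m gram Q b *m M^T.
Proof.
move=> Qsb; apply/matrixP => i j; rewrite mxE !tnth_mktuple form_lincomb //.
by rewrite -row_mul [LHS]mxE [RHS]mxE; apply: eq_bigr => k _; rewrite !mxE.
Qed.

Lemma posdef_gram_form Q b : symmetric_bilinear Q ->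
  (forall v, v != 0 -> 0 < Q v v) -> basis_of fullv b -> posdef (gram Q b).
Proof.
move=> Qsb Qpos bb; split.
  by apply/matrixP => i j; rewrite !mxE; exact: Qsb.2.
move=> x x0; rewrite /qform -form_lincomb //; apply: Qpos.
by apply: contraNneq x0 => /((basis_lincombP b).1 bb).2 ->.
Qed.

Lemma zbasis_lattice A b : zbasis A b -> lattice A.
Proof.
move=> zb; have nE : n = \dim {:V}.
  by rewrite -(span_basis zb.1) (eqnP (basis_free zb.1)) size_tuple.
by rewrite /lattice -nE; exists b.
Qed.

End Lincomb.

Section Iso.
Variables (R : realType) (n : nat).
Implicit Types X Y : pptav R n.

Lemma periods_zbasis X : exists b : n.-tuple X, zbasis (periods X) b.
Proof.
by have := periodsP X; rewrite /lattice dim_space.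
Qed.

Lemma lincomb_map (V W : vectType R) (f : {linear V -> W}) (b : n.-tuple V) x :
  lincomb (map_tuple f b) x = f (lincomb b x).
Proof.
by rewrite linear_sum; apply: eq_bigr => i _; rewrite tnth_map linearZ.
Qed.

(** A principal polarization determines the integral structure: the lattice of
    the integral structure is its own double dual, and its dual is the image of
    the period lattice. *)
Lemma affine_latticeE X v : affine_lattice X v <->
  forall u, periods X u -> pol_form X u v \is a Num.int.
Proof.
split=> [Lv u Pu|Qint].
  have [_] := pol_form_chern (ex_intro2 _ _ u Pu erefl); exact.
have [b /zbasisP[bb LE]] := affine_latticeP X.
have vE := coord_basis bb (memvf v).
apply/LE; exists (\row_i Num.floor (coord b i v)).
rewrite {1}vE; apply: eq_bigr => i _; rewrite -tnth_nth; congr (_ *: _).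
rewrite !mxE floorK //.
(* The coordinates in a basis of L are integral on L, so they come from periods. *)
have : dual_lattice (affine_lattice X) (coord b i).
  split=> [a u w|w /LE[a ->]]; first by rewrite linearP.
  rewrite /lincomb; under eq_bigr do rewrite (tnth_nth 0).
  by rewrite coord_sum_free ?mxE ?intr_int // (basis_free bb).
by rewrite -principal => -[u Pu <-]; exact: Qint.
Qed.

Lemma linear_basis (V W : vectType R) (b : n.-tuple V) (c : n.-tuple W) :
  basis_of fullv b ->
  {f : {linear V -> W} | forall x, f (lincomb b x) = lincomb c x}.
Proof.
move=> bb; have [f fE] := linear_of_free b c; exists f => x.
have fbc : map_tuple f b = c.
  by apply/val_inj; rewrite /= fE ?(basis_free bb) // !size_tuple.
by rewrite -lincomb_map fbc.
Qed.

(** From right to left: the linear map between two bases with the same Gram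
    matrix preserves the periods and the form, and hence also the lattice of
    the integral structure, by [affine_latticeE]. *)
Lemma pptav_isoP X Y (b : n.-tuple X) (c : n.-tuple Y) :
  zbasis (periods X) b -> zbasis (periods Y) c ->
  pptav_iso X Y <-> exists2 z : 'M[int]_n, z \in unitmx &
    gram (pol_form Y) c =
    map_mx intr z *m gram (pol_form X) b *m (map_mx intr z)^T.
Proof.
move=> zb zc; have QX := pol_form_bilinear X; have QY := pol_form_bilinear Y.
split=> [[f [[g fK gK] fP _ fQ]]|[z zU cE]].
  have zfb : zbasis (periods Y) (map_tuple f b).
    have /zbasisP[bb PE] := zb; have [surj _] := (basis_lincombP b).1 bb.
    apply/zbasisP; split.
      apply/basis_lincombP; split=> [v|x].
        by have [x xE] := surj (g v); exists x; rewrite lincomb_map -xE gK.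
      rewrite lincomb_map -(linear0 f) => /(can_inj fK).
      by rewrite -(linear0 (lincomb b)) => /(lincomb_inj bb).
    move=> v; rewrite -fP; split=> [[u /PE[a ->] <-]|[a ->]].
      by exists a; rewrite lincomb_map.
    by rewrite lincomb_map; exists (lincomb b (map_mx intr a)) => //; apply/PE; exists a.
  have [z zU ->] := zbasis_change zfb zc; exists z => //.
  rewrite gram_mxact //; congr (_ *m _ *m _).
  by apply/matrixP => i j; rewrite !mxE !tnth_map fQ.
pose b' := mxact (map_mx intr z) b.
have zb' : zbasis (periods X) b' by exact: zbasis_mxact.
have gE : gram (pol_form X) b' = gram (pol_form Y) c by rewrite gram_mxact.
have /zbasisP[bb' PX] := zb'; have /zbasisP[bc PY] := zc.
have [surjb _] := (basis_lincombP b').1 bb'.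
have [surjc _] := (basis_lincombP c).1 bc.
have [f fE] := linear_basis c bb'; have [g gE'] := linear_basis b' bc.
have fQ u v : pol_form Y (f u) (f v) = pol_form X u v.
  have [x ->] := surjb u; have [y ->] := surjb v.
  by rewrite !fE !form_lincomb // gE.
have fK : cancel f g by move=> u; have [x ->] := surjb u; rewrite fE gE'.
have gK : cancel g f by move=> u; have [x ->] := surjc u; rewrite gE' fE.
have fP u : periods Y (f u) <-> periods X u.
  have [x ->] := surjb u; rewrite fE PX PY; split=> -[a E]; exists a.
    by congr (lincomb _ _); exact: (lincomb_inj bc).
  by congr (lincomb _ _); exact: (lincomb_inj bb').
exists f; split=> //; first by exists g.
  apply/seteqP; split=> [_ [u Pu <-]|v Pv]; first exact/fP.
  by exists (g v); rewrite ?gK //; apply/fP; rewrite gK.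
apply/seteqP; split=> [_ [u /affine_latticeE Lu <-]|v /affine_latticeE Lv].
  by apply/affine_latticeE => w Pw; rewrite -(gK w) fQ; apply/Lu/fP; rewrite gK.
exists (g v); rewrite ?gK //; apply/affine_latticeE => w Pw.
by rewrite -fQ gK; apply/Lv/fP.
Qed.

End Iso.

(** * The bijection between the moduli set and the double coset space *)

Section ModuliMap.
Variables (R : realType) (n : nat).

Definition std_basis : n.-tuple 'rV[R]_n := [tuple delta_mx 0 i | i < n].

Lemma lincomb_std x : lincomb std_basis x = x.
Proof.
rewrite [RHS]row_sum_delta; apply: eq_bigr => i _.
by rewrite tnth_mktuple.
Qed.

Lemma zbasis_inIntSpan (b : n.-tuple 'rV[R]_n) :
  basis_of fullv b -> zbasis [set v | inIntSpan b v] b.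
Proof. by []. Qed.

Lemma basis_mxact_std (M : 'M[R]_n) :
  M \in unitmx -> basis_of fullv (mxact M std_basis).
Proof.
move=> MU; apply/basis_lincombP; split=> [v|x]; rewrite ?lincomb_mxact.
  by exists (v *m invmx M); rewrite lincomb_mxact lincomb_std mulmxKV.
by rewrite lincomb_std => xM; rewrite -(mulmxK MU x) xM mul0mx.
Qed.

Lemma scalar_rowE (f : 'rV[R]_n -> R) : scalar f ->
  forall v, f v = (v *m \col_i f (delta_mx 0 i)) 0 0.
Proof.
move=> flin v; pose g : {scalar 'rV[R]_n} :=
  HB.pack f (GRing.isLinear.Build R 'rV[R]_n R *%R f flin).
rewrite -[f]/(g : _ -> R) {1}[v]row_sum_delta linear_sum mxE.
by apply: eq_bigr => i _; rewrite linearZ mxE.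
Qed.

(** Take R^n with the form A, the periods Z^n, and for integral structure the
    lattice dual to Z^n under A, which the rows of the inverse of A generate. *)
Lemma pptav_of_gram (A : 'M[R]_n) : posdef A ->
  exists (X : pptav R n) (b : n.-tuple X),
    zbasis (periods X) b /\ gram (pol_form X) b = A.
Proof.
move=> Apd; have AU := posdef_unit Apd; have [AT Apos] := Apd.
have dimV : \dim {:'rV[R]_n} = n by rewrite dimvf /dim /= mul1n.
pose e := std_basis; pose l := mxact (invmx A) e.
have ze : zbasis [set v | inIntSpan e v] e.
  apply: zbasis_inIntSpan; rewrite -[e]mxact1; exact/basis_mxact_std/unitmx1.
have zl : zbasis [set v | inIntSpan l v] l.
  by apply/zbasis_inIntSpan/basis_mxact_std; rewrite unitmx_inv.
pose T := TropicalTorus dimV (zbasis_lattice ze) (zbasis_lattice zl).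
pose Q (u v : 'rV[R]_n) : R := (u *m A *m v^T) 0 0.
have Qsym u v : Q u v = Q v u.
  rewrite /Q (_ : u *m A *m v^T = (v *m A *m u^T)^T) ?mxE //.
  by rewrite !trmx_mul trmxK AT mulmxA.
have Qlin u : scalar (Q u).
  by move=> a v w; rewrite /Q linearP /= mulmxDr -scalemxAr !mxE.
have Qint : chern Q @` periods T `<=` dual_lattice (affine_lattice T).
  move=> _ [u /inIntSpanP[a ->] <-]; split=> // v /inIntSpanP[c ->].
  rewrite /chern /Q lincomb_mxact !lincomb_std !trmx_mul trmx_inv AT.
  by rewrite !mulmxA mulmxK // map_trmx -map_mxM mxE intr_int.
have Qdual : chern Q @` periods T = dual_lattice (affine_lattice T).
  apply/seteqP; split=> // f [flin fint].
  pose c : 'cV[R]_n := \col_i f (delta_mx 0 i).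
  have fE v : f v = (v *m c) 0 0 by exact: scalar_rowE.
  (* The vector representing f under A; its i-th coordinate is the value of f
     at the i-th generator of the dual lattice. *)
  pose u := (invmx A *m c)^T.
  have uint i : u 0 i \is a Num.int.
    have : f (tnth l i) \is a Num.int.
      apply/fint/inIntSpanP; exists (delta_mx 0 i).
      by rewrite map_delta_mx lincomb_delta.
    by rewrite fE tnth_mktuple lincomb_std -row_mul !mxE.
  exists u.
    apply/inIntSpanP; exists (\row_i Num.floor (u 0 i)).
    by rewrite lincomb_std; apply/rowP => i; rewrite [RHS]mxE [X in X%:~R]mxE floorK.
  apply/funext => v; rewrite /chern Qsym fE /Q /u trmxK mulmxA.
  by rewrite mulmxK.
have Qpos (v : T) : v != 0 -> 0 < Q v v by exact: Apos.
pose P := @PolarizedTAV R n T Q (conj Qlin Qsym) Qint Qpos.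
exists (@PPTAV R n P Qdual), e; split=> //.
apply/matrixP => i j; rewrite mxE !tnth_mktuple /= /Q.
by rewrite -rowE trmx_delta -colE !mxE.
Qed.

Lemma pptav_posdef (X : pptav R n) (b : n.-tuple X) :
  zbasis (periods X) b -> posdef (gram (pol_form X) b).
Proof.
move=> [bb _]; apply: posdef_gram_form => //; first exact: pol_form_bilinear.
exact: pol_form_posdef.
Qed.

Lemma pptav_iso_gram_class (X Y : pptav R n) (b : n.-tuple X) (c : n.-tuple Y) :
  zbasis (periods X) b -> zbasis (periods Y) c ->
  pptav_iso X Y <->
  gram_class (gram (pol_form X) b) = gram_class (gram (pol_form Y) c).
Proof.
move=> zb zc; rewrite (pptav_isoP zb zc).
by rewrite (gram_class_eq (pptav_posdef zb) (pptav_posdef zc)).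
Qed.

Definition gram_class_of (C : trop_moduli R n) (y : locsym R n) : Prop :=
  exists (X : pptav R n) (b : n.-tuple X),
    [/\ sval C = pptav_iso X, zbasis (periods X) b &
        y = gram_class (gram (pol_form X) b)].

Lemma gram_class_of_ex C : exists y, gram_class_of C y.
Proof.
case: C => C [X CX]; have [b zb] := periods_zbasis X.
by exists (gram_class (gram (pol_form X) b)), X, b.
Qed.

(** The choice is made among values of the map, which do not depend on the
    representative X of the class or on the basis b. *)
Definition moduli_map (C : trop_moduli R n) : locsym R n :=
  sval (cid (gram_class_of_ex C)).

Lemma pptav_iso_refl (X : pptav R n) : pptav_iso X X.
Proof.
have [b zb] := periods_zbasis X.
exact/(pptav_iso_gram_class zb zb).
Qed.

Lemma moduli_mapE (X : pptav R n) (b : n.-tuple X) : zbasis (periods X) b ->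
  moduli_map (tav_class X) = gram_class (gram (pol_form X) b).
Proof.
move=> zb; rewrite /moduli_map; case: cid => y [Y [c [/= XY zc ->]]].
by apply/(pptav_iso_gram_class zc zb); rewrite -XY; exact: pptav_iso_refl.
Qed.

Lemma moduli_map_inj : injective moduli_map.
Proof.
case=> C [X CX] [D [Y DY]]; subst C D => CD.
have [b zb] := periods_zbasis X; have [c zc] := periods_zbasis Y.
have {}CD : gram_class (gram (pol_form X) b) = gram_class (gram (pol_form Y) c).
  by rewrite -(moduli_mapE zb) -(moduli_mapE zc).
apply: eq_exist; apply/funext => Z; apply/propext.
have [d zd] := periods_zbasis Z.
by rewrite (pptav_iso_gram_class zb zd) (pptav_iso_gram_class zc zd) CD.
Qed.

Lemma moduli_map_surj y : exists C, moduli_map C = y.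
Proof.
have [g ->] := gram_class_surj y.
have [X [b [zb <-]]] := pptav_of_gram (posdef_gram (GLn_unit g)).
by exists (tav_class X); exact: moduli_mapE.
Qed.

Lemma moduli_map_bij : bijective moduli_map.
Proof.
exists (fun y => sval (cid (moduli_map_surj y))) => [C|y].
  by apply: moduli_map_inj; case: cid.
by case: cid.
Qed.

End ModuliMap.

(** * Coordinates on symmetric matrices *)

Section SymCoordinates.
Variables (R : realType) (n : nat).

Definition sympos : finType := {p : 'I_n * 'I_n | (p.1 <= p.2)%N}.

(** Column j contains j + 1 positions on or above the diagonal. *)
Lemma card_sympos : #|sympos| = ((n * n.+1) %/ 2)%N.
Proof.
rewrite card_sig -sum1_card.
rewrite (eq_bigl (fun p : 'I_n * 'I_n => true && (p.1 <= p.2)%N)) //.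
rewrite -(pair_big_dep xpredT (fun i j : 'I_n => (i <= j)%N) (fun _ _ => 1%N)) /=.
rewrite (exchange_big_dep xpredT) //=.
under eq_bigr => j _ do
  rewrite -(big_ord_widen n (fun=> 1%N) (ltn_ord j)) sum1_card card_ord.
rewrite -(big_mkord xpredT S) -(big_add1 _ _ 0 n.+1 xpredT id).
have -> : (\sum_(1 <= i < n.+1) i = \sum_(0 <= i < n.+1) i)%N.
  by rewrite [RHS]big_nat_recl // add0n big_add1.
by rewrite bin2_sum bin2 divn2 mulnC.
Qed.

Local Notation d := ((n * n.+1) %/ 2)%N.

Definition upper_pos (i j : 'I_n) : 'I_n * 'I_n :=
  if (i <= j)%N then (i, j) else (j, i).

Lemma upper_posP i j : ((upper_pos i j).1 <= (upper_pos i j).2)%N.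
Proof. by rewrite /upper_pos; have [//|/ltnW] := leqP i j. Qed.

Definition sympos_of (i j : 'I_n) : sympos := Sub (upper_pos i j) (upper_posP i j).

Definition sym_mx (u : 'rV[R]_d) : 'M[R]_n :=
  \matrix_(i, j) u 0 (cast_ord card_sympos (enum_rank (sympos_of i j))).

Definition coord_pos (k : 'I_d) : sympos :=
  enum_val (cast_ord (esym card_sympos) k).

Definition sym_coord (M : 'M[R]_n) : 'rV[R]_d :=
  \row_k M (val (coord_pos k)).1 (val (coord_pos k)).2.

Lemma sym_mxK : cancel sym_mx sym_coord.
Proof.
move=> u; apply/rowP => k; rewrite !mxE.
have -> : sympos_of (val (coord_pos k)).1 (val (coord_pos k)).2 = coord_pos k.
  by apply/val_inj; rewrite /= /upper_pos (valP (coord_pos k)) -surjective_pairing.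
by rewrite enum_valK cast_ordKV.
Qed.

Lemma sym_mx_sym u : (sym_mx u)^T = sym_mx u.
Proof.
apply/matrixP => i j; rewrite !mxE; congr (u 0 (cast_ord _ (enum_rank _))).
apply/val_inj; rewrite /= /upper_pos.
by case: ltngtP => // /val_inj ->.
Qed.

Lemma sym_coordK M : M^T = M -> sym_mx (sym_coord M) = M.
Proof.
move=> MT; apply/matrixP => i j; rewrite !mxE /coord_pos cast_ordK enum_rankK /=.
by rewrite /upper_pos; case: ifP => _ //=; rewrite -[in LHS]MT mxE.
Qed.

Lemma sym_mx_is_linear : linear sym_mx.
Proof. by move=> a u v; apply/matrixP => i j; rewrite !mxE. Qed.

Lemma sym_coord_is_linear : linear sym_coord.
Proof. by move=> a u v; apply/rowP => i; rewrite !mxE. Qed.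

HB.instance Definition _ :=
  GRing.isLinear.Build R 'rV[R]_d 'M[R]_n _ sym_mx sym_mx_is_linear.
HB.instance Definition _ :=
  GRing.isLinear.Build R 'M[R]_n 'rV[R]_d _ sym_coord sym_coord_is_linear.

Lemma cvg_sym_mx (T : Type) (F : set_system T) {FF : Filter F}
    (f : T -> 'rV[R]_d) (u : 'rV[R]_d) :
  f @ F --> u -> sym_mx (f t) @[t --> F] --> sym_mx u.
Proof.
move=> /cvg_mxP fu; apply/cvg_mxP => i j.
by under eq_cvg do rewrite mxE; rewrite mxE; exact: fu.
Qed.

Lemma cvg_sym_coord (T : Type) (F : set_system T) {FF : Filter F}
    (f : T -> 'M[R]_n) (M : 'M[R]_n) :
  f @ F --> M -> sym_coord (f t) @[t --> F] --> sym_coord M.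
Proof.
move=> /cvg_mxP fM; apply/cvg_mxP => i j.
by under eq_cvg do rewrite mxE; rewrite mxE; exact: fM.
Qed.

End SymCoordinates.

(** * The Frobenius norm *)

Section Frobenius.
Variables (R : realType) (n : nat).
Implicit Types (T w : 'M[R]_n) (x : 'rV[R]_n).

Definition sqfrob T : R := \sum_i \sum_j T i j ^+ 2.

Lemma sqfrob_tr T : sqfrob T = \tr (T *m T^T).
Proof.
apply: eq_bigr => i _; rewrite mxE; apply: eq_bigr => j _.
by rewrite mxE expr2.
Qed.

Lemma sqfrob0 : sqfrob 0 = 0.
Proof. by rewrite sqfrob_tr mul0mx mxtrace0. Qed.

Lemma cvg_sqfrob (I : Type) (F : set_system I) {FF : Filter F}
    (f : I -> 'M[R]_n) (T : 'M[R]_n) :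
  f @ F --> T -> sqfrob (f t) @[t --> F] --> sqfrob T.
Proof.
move=> fT; rewrite sqfrob_tr; under eq_cvg do rewrite sqfrob_tr.
have /cvg_mxP TT : f t *m (f t)^T @[t --> F] --> T *m T^T.
  exact: (cvg_mulmx fT (cvg_trmx fT)).
by apply: cvg_big => [|i _]; [exact: add_continuous|exact: TT].
Qed.

Lemma sqfrob_conj w T : w *m w^T = 1%:M -> sqfrob (w *m T *m w^T) = sqfrob T.
Proof.
move=> wO; have wO' : w^T *m w = 1%:M by exact: mulmx1C.
rewrite !sqfrob_tr !trmx_mul trmxK !mulmxA -(mulmxA _ w^T) wO' mulmx1.
by rewrite mxtrace_mulC !mulmxA wO' mul1mx.
Qed.

Lemma sqfrob_ge_entry T i j : T i j ^+ 2 <= sqfrob T.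
Proof.
rewrite /sqfrob (bigD1 i) //= (bigD1 j) //= -addrA lerDl addr_ge0 //.
  by apply: sumr_ge0 => k _; exact: sqr_ge0.
by apply: sumr_ge0 => k _; apply: sumr_ge0 => l _; exact: sqr_ge0.
Qed.

Lemma entry_le_sqfrob T i j e : 0 <= e -> sqfrob T <= e ^+ 2 -> `|T i j| <= e.
Proof.
move=> e0 Te; rewrite -ler_sqr ?nnegrE // real_normK ?num_real //.
exact: le_trans (sqfrob_ge_entry T i j) Te.
Qed.

Lemma qformE T x : qform T x = \sum_i \sum_j x 0 i * T i j * x 0 j.
Proof.
rewrite /qform mxE exchange_big; apply: eq_bigr => j _.
by rewrite !mxE mulr_suml.
Qed.

Lemma qform1E x : qform 1%:M x = \sum_i x 0 i ^+ 2.
Proof.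
by rewrite /qform mulmx1 mxE; apply: eq_bigr => i _; rewrite mxE expr2.
Qed.

(** The Cauchy-Schwarz inequality for the matrices T and x^T *m x, as the
    nonnegativity of a quadratic polynomial in c. *)
Lemma sqfrob_rank1_ge0 T x c :
  0 <= sqfrob T + 2 * c * qform T x + c ^+ 2 * qform 1%:M x ^+ 2.
Proof.
have -> : sqfrob T + 2 * c * qform T x + c ^+ 2 * qform 1%:M x ^+ 2 =
    \sum_i \sum_j (T i j + c * x 0 i * x 0 j) ^+ 2.
  have -> : qform 1%:M x ^+ 2 = \sum_i \sum_j x 0 i ^+ 2 * x 0 j ^+ 2.
    rewrite qform1E expr2 mulr_suml; apply: eq_bigr => i _.
    by rewrite mulr_sumr.
  rewrite qformE !mulr_sumr -!big_split /=.
  apply: eq_bigr => i _; rewrite !mulr_sumr -!big_split /=.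
  by apply: eq_bigr => j _; ring.
by apply: sumr_ge0 => i _; apply: sumr_ge0 => j _; exact: sqr_ge0.
Qed.

(** The quadratic polynomial is evaluated at c = 1 / (2 |x|^2), which gives
    x T x^T >= - (|T|^2 + 1/4) |x|^2. *)
Lemma qform_perturb T x : sqfrob T <= 4^-1 ->
  2^-1 * qform 1%:M x <= qform (1%:M + T) x.
Proof.
move=> T4; rewrite {2}/qform mulmxDr mulmxDl mxE -/(qform 1%:M x) -/(qform T x).
have [->|x0] := eqVneq x 0.
  by rewrite /qform !mul0mx mxE mulr0 addr0.
have N0 : 0 < qform 1%:M x by exact: (posdef1 R n).2.
have := sqfrob_rank1_ge0 T x (2 * qform 1%:M x)^-1.
move: N0; set N := qform 1%:M x; set q := qform T x => N0.
have -> : 2 * (2 * N)^-1 * q = q / N by field; rewrite gt_eqF.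
have -> : (2 * N)^-1 ^+ 2 * N ^+ 2 = 4^-1 :> R by field; rewrite gt_eqF.
move=> h; have : - 2^-1 <= q / N by lra.
by rewrite ler_pdivlMr // => hq; lra.
Qed.

Lemma posdef_perturb T : T^T = T -> sqfrob T <= 4^-1 -> posdef (1%:M + T).
Proof.
move=> TT T4; split; first by rewrite linearD /= trmx1 TT.
move=> x x0; apply: lt_le_trans (qform_perturb x T4).
by rewrite mulr_gt0 ?invr_gt0 //; exact: (posdef1 R n).2.
Qed.

(** Comparing diagonal entries, the i-th row r of w satisfies
    |r|^2 / 2 <= r (1 + T) r^T = 1 + T' i i <= 2. *)
Lemma entry_near_orthogonal w T T' :
  sqfrob T <= 4^-1 -> sqfrob T' <= 4^-1 ->
  w *m (1%:M + T) *m w^T = 1%:M + T' -> forall i j, `|w i j| <= 2.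
Proof.
move=> T4 T'4 wE i j.
have half : 4^-1 = 2^-1 ^+ 2 :> R by field.
have T'i : `|T' i i| <= 2^-1 by apply: entry_le_sqfrob; rewrite -?half ?invr_ge0.
have rowE : qform (1%:M + T) (row i w) = 1 + T' i i.
  have := congr1 (fun M : 'M[R]_n => M i i) wE; rewrite [RHS]mxE [1%:M i i]mxE eqxx => <-.
  rewrite /qform -row_mul [LHS]mxE [RHS]mxE.
  by apply: eq_bigr => k _; rewrite !mxE.
have := qform_perturb (row i w) T4; rewrite rowE qform1E => le1.
have : w i j ^+ 2 <= \sum_k row i w 0 k ^+ 2.
  by rewrite (bigD1 j) //= mxE lerDl; apply: sumr_ge0 => k _; exact: sqr_ge0.
move=> le2; rewrite -ler_sqr ?nnegrE // real_normK ?num_real //.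
apply: le_trans le2 _; have := le_trans (ler_norm _) T'i; lra.
Qed.

(** Otherwise w *m w^T - 1 = T' - w *m T *m w^T would be small. *)
Lemma gap_nonorthogonal w : w *m w^T <> 1%:M -> exists2 e : R, 0 < e &
  forall T T', sqfrob T <= e -> sqfrob T' <= e ->
    w *m (1%:M + T) *m w^T <> 1%:M + T'.
Proof.
move=> wO.
have [i [j Dij]] : exists i j, (w *m w^T - 1%:M) i j != 0.
  apply: contrapT => noD; apply: wO; apply/eqP; rewrite -subr_eq0; apply/eqP.
  apply/matrixP => i j; rewrite [RHS]mxE; apply/eqP/negPn/negP => Dij.
  by apply: noD; exists i, j.
set D := (w *m w^T - 1%:M) i j in Dij.
(* With entries of T and T' at most e, the entry D is at most e * K. *)
pose K := 1 + \sum_k \sum_l `|w i l| * `|w j k|.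
have K0 : 0 < K.
  by rewrite ltr_pwDl //; apply: sumr_ge0 => k _; apply: sumr_ge0 => l _;
     rewrite mulr_ge0.
pose e := `|D| / (2 * K).
have e0 : 0 < e by rewrite divr_gt0 ?normr_gt0 // mulr_gt0.
exists (e ^+ 2); first exact: exprn_gt0.
move=> T T' Te T'e E.
have DE : D = T' i j - (w *m T *m w^T) i j.
  rewrite /D; have := congr1 (fun M : 'M[R]_n => M i j) E.
  rewrite mulmxDr mulmx1 mulmxDl !mxE => E'; lra.
have : `|D| <= e * K.
  rewrite DE (le_trans (ler_normB _ _)) // /K mulrDr mulr1 lerD //.
    exact: entry_le_sqfrob (ltW e0) T'e.
  rewrite mxE mulr_sumr (le_trans (ler_norm_sum _ _ _)) //.
  apply: ler_sum => k _; rewrite mxE mulr_suml mulr_sumr.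
  rewrite (le_trans (ler_norm_sum _ _ _)) //; apply: ler_sum => l _.
  rewrite !normrM mxE mulrAC mulrC ler_wpM2r ?mulr_ge0 //.
  exact: entry_le_sqfrob (ltW e0) Te.
have -> : e * K = `|D| / 2 by rewrite /e; field; rewrite gt_eqF.
have : 0 < `|D| by rewrite normr_gt0.
lra.
Qed.

End Frobenius.

(** * Orbifold charts *)

Lemma finite_int_mx (n N : nat) :
  finite_set [set z : 'M[int]_n | forall i j, `|z i j| <= N%:Z].
Proof.
pose f (k : 'M['I_(N + N).+1]_n) : 'M[int]_n :=
  \matrix_(i, j) ((k i j)%:Z - N%:Z).
apply: (@sub_finite_set _ _ (f @` setT)); last exact/finite_image/finite_finset.
move=> z zN; exists (\matrix_(i, j) inord (absz (z i j + N%:Z))) => //.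
(* Entries are shifted by N to make them nonnegative. *)
apply/matrixP => i j; rewrite !mxE; have := zN i j => zij.
rewrite inordK; lia.
Qed.

Lemma congr_mxK (R : realType) (n : nat) (a b S : 'M[R]_n) :
  a *m b = 1%:M -> a *m (b *m S *m b^T) *m a^T = S.
Proof.
by move=> ab; rewrite !mulmxA ab mul1mx -mulmxA -trmx_mul ab trmx1 mulmx1.
Qed.

Section Chart.
Variables (R : realType) (n : nat) (g : 'M[R]_n).
Hypothesis gU : g \in unitmx.

Local Notation d := ((n * n.+1) %/ 2)%N.

(** The action of z in the parameter T of g *m (1 + T) *m g^T; in this
    parameter the centre is the identity matrix, so that the stabilizer of the
    centre becomes a group of orthogonal matrices. *)
Definition conj_int (z : 'M[int]_n) : 'M[R]_n := invmx g *m map_mx intr z *m g.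

Lemma conj_intK z : g *m conj_int z *m invmx g = map_mx intr z.
Proof. by rewrite /conj_int !mulmxA mulmxV // mul1mx mulmxK. Qed.

Lemma conj_intM z z' : conj_int (z *m z') = conj_int z *m conj_int z'.
Proof. by rewrite /conj_int map_mxM !mulmxA mulmxK. Qed.

Lemma conj_int1 : conj_int 1%:M = 1%:M.
Proof. by rewrite /conj_int map_mx1 mulmx1 mulVmx. Qed.

Definition near_orthogonal (w : 'M[R]_n) : Prop := exists T T',
  [/\ sqfrob T <= 4^-1, sqfrob T' <= 4^-1 &
      w *m (1%:M + T) *m w^T = 1%:M + T'].

Lemma orthogonal_near w : w *m w^T = 1%:M -> near_orthogonal w.
Proof.
by move=> wO; exists 0, 0; rewrite sqfrob0 invr_ge0 addr0 mulmx1.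
Qed.

Lemma finite_near_orthogonal :
  finite_set [set z : 'M[int]_n | near_orthogonal (conj_int z)].
Proof.
pose B : R := \sum_i \sum_j \sum_l \sum_k `|g i k| * 2 * `|invmx g l j|.
have B0 i j l k : 0 <= `|g i k| * 2 * `|invmx g l j| by rewrite !mulr_ge0.
have B_ge0 : 0 <= B by do 4! (apply: sumr_ge0 => ? _).
apply: sub_finite_set (@finite_int_mx n (Num.bound B)) => z [T [T' [T4 T'4 zT]]].
have w2 := entry_near_orthogonal T4 T'4 zT.
move=> i j; rewrite -(ler_int R) intr_norm.
apply: le_trans (ltW (archi_boundP B_ge0)).
have -> : (z i j)%:~R = (g *m conj_int z *m invmx g) i j.
  by rewrite conj_intK mxE.
rewrite /B (bigD1 i) //= (bigD1 j) //= -addrA ler_wpDr //.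
  by rewrite addr_ge0 //; repeat (apply: sumr_ge0 => ? _).
rewrite mxE (le_trans (ler_norm_sum _ _ _)) //; apply: ler_sum => l _.
rewrite mxE normrM -mulr_suml ler_wpM2r //.
rewrite (le_trans (ler_norm_sum _ _ _)) //; apply: ler_sum => k _.
by rewrite normrM ler_wpM2l.
Qed.

(** Proper discontinuity near g *m g^T: only finitely many integral matrices
    carry some point of the ball with e = 1/4 into that ball, and each of those
    that do not fix the centre stops doing so on a smaller ball. *)
Lemma chart_radius : exists e : R, [/\ 0 < e, e <= 4^-1 &
  forall z T T', sqfrob T < e -> sqfrob T' < e ->
    conj_int z *m (1%:M + T) *m (conj_int z)^T = 1%:M + T' ->
    conj_int z *m (conj_int z)^T = 1%:M].
Proof.
have /finite_seqP[s sE] := finite_near_orthogonal.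
have [e [e0 gap]] : exists e : R, 0 < e /\ forall z T T', z \in s ->
    sqfrob T <= e -> sqfrob T' <= e ->
    conj_int z *m (1%:M + T) *m (conj_int z)^T = 1%:M + T' ->
    conj_int z *m (conj_int z)^T = 1%:M.
  elim: (s) => [|z t [e [e0 IH]]]; first by exists 1.
  have [zO|/gap_nonorthogonal[e' e'0 e'P]] :=
      pselect (conj_int z *m (conj_int z)^T = 1%:M).
    exists e; split=> // y T T'; rewrite inE => /orP[/eqP->//|]; exact: IH.
  exists (Num.min e e'); split; first by rewrite lt_min e0.
  move=> y T T'; rewrite inE !le_min => /orP[/eqP->|yt] /andP[Te Te'] /andP[T'e T'e'].
    by move=> /(e'P _ _ Te' T'e').
  exact: IH.
exists (Num.min e 4^-1); split; first by rewrite lt_min e0 invr_gt0 ltr0n.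
  by rewrite ge_min lexx orbT.
move=> z T T'; rewrite !lt_min => /andP[/ltW Te /ltW T4] /andP[/ltW T'e /ltW T'4] zT.
apply: (gap z T T' _ Te T'e zT).
by have : [set` s] z by rewrite -sE; exists T, T'.
Qed.

Definition chart_mx (u : 'rV[R]_d) : 'M[R]_n := g *m (1%:M + sym_mx u) *m g^T.

Definition sym_act (w : 'M[R]_n) (u : 'rV[R]_d) : 'rV[R]_d :=
  sym_coord (w *m sym_mx u *m w^T).

Lemma sym_act_is_linear w : linear (sym_act w).
Proof.
move=> a u v.
by rewrite /sym_act linearP mulmxDr mulmxDl -scalemxAr -scalemxAl linearP.
Qed.

HB.instance Definition _ w :=
  GRing.isLinear.Build R 'rV[R]_d 'rV[R]_d _ (sym_act w) (sym_act_is_linear w).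

Definition sym_act_mx (w : 'M[R]_n) : 'M[R]_d := lin1_mx (sym_act w).

Lemma sym_mx_act w u : sym_mx (u *m sym_act_mx w) = w *m sym_mx u *m w^T.
Proof.
rewrite mul_rV_lin1 /= sym_coordK // !trmx_mul trmxK sym_mx_sym.
by rewrite mulmxA.
Qed.

Lemma sym_act_mxM w w' : sym_act_mx w *m sym_act_mx w' = sym_act_mx (w' *m w).
Proof.
apply/row_matrixP => i; rewrite !rowE mulmxA.
apply: (can_inj (@sym_mxK R n)); rewrite !sym_mx_act.
by rewrite trmx_mul !mulmxA.
Qed.

Lemma sym_act_mx1 : sym_act_mx 1%:M = 1%:M.
Proof.
apply/row_matrixP => i; rewrite !rowE mulmx1.
apply: (can_inj (@sym_mxK R n)); rewrite sym_mx_act.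
by rewrite trmx1 mulmx1 mul1mx.
Qed.

Definition chart_group : set 'M[R]_d :=
  [set sym_act_mx (conj_int z) | z in [set z : 'M[int]_n |
     z \in unitmx /\ conj_int z *m (conj_int z)^T = 1%:M]].

Lemma chart_group_finite : finite_linear_group chart_group.
Proof.
split.
- apply: finite_image; apply: sub_finite_set finite_near_orthogonal.
  by move=> z [_ /orthogonal_near].
- move=> _ [z [zU _] <-].
  suff /mulmx1_unit[] : sym_act_mx (conj_int z) *m
      sym_act_mx (conj_int (invmx z)) = 1%:M by [].
  by rewrite sym_act_mxM -conj_intM mulVmx // conj_int1 sym_act_mx1.
- exists 1%:M; last by rewrite conj_int1 sym_act_mx1.
  by split; [exact: unitmx1|rewrite conj_int1 trmx1 mulmx1].
- move=> _ _ [z [zU zO] <-] [y [yU yO] <-]; exists (y *m z).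
    split; first by rewrite unitmx_mul yU.
    by rewrite conj_intM trmx_mul mulmxA -(mulmxA _ _ (conj_int z)^T) zO mulmx1.
  by rewrite conj_intM sym_act_mxM.
Qed.

Definition chart_dom (e : R) : set 'rV[R]_d := [set u | sqfrob (sym_mx u) < e].

Lemma open_chart_dom e : open (chart_dom e).
Proof.
rewrite openE => u ue.
have sqcvg : sqfrob (sym_mx v) @[v --> u] --> sqfrob (sym_mx u).
  apply: (@cvg_sqfrob R n _ (nbhs u) _).
  by apply: (@cvg_sym_mx R n _ (nbhs u) _ id); exact: cvg_id.
exact: (cvgr_lt _ sqcvg _ ue).
Qed.

Lemma chart_mx_posdef e u : e <= 4^-1 -> chart_dom e u -> posdef (chart_mx u).
Proof.
move=> e4 ue; apply/posdef_congr/posdef_perturb => //; first exact: sym_mx_sym.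
exact: ltW (lt_le_trans ue e4).
Qed.

Lemma cvg_chart_mx (T : Type) (F : set_system T) {FF : Filter F}
    (f : T -> 'rV[R]_d) (u : 'rV[R]_d) :
  f @ F --> u -> chart_mx (f t) @[t --> F] --> chart_mx u.
Proof.
move=> fu; apply: cvg_mulmx; last exact: cvg_cst.
apply: cvg_mulmx; first exact: cvg_cst.
by apply: cvg_addmx; [exact: cvg_cst|exact: cvg_sym_mx].
Qed.

Lemma chart_mx_conj z u v :
  chart_mx v = map_mx intr z *m chart_mx u *m (map_mx intr z)^T <->
  conj_int z *m (1%:M + sym_mx u) *m (conj_int z)^T = 1%:M + sym_mx v.
Proof.
rewrite -{1 2}conj_intK.
have -> w : g *m w *m invmx g *m chart_mx u *m (g *m w *m invmx g)^T =
    g *m (w *m (1%:M + sym_mx u) *m w^T) *m g^T.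
  rewrite /chart_mx !trmx_mul trmx_inv !mulmxA mulmxKV //.
  by rewrite mulmxK ?unitmx_tr.
split=> [|->//] /(congr1 (fun M => invmx g *m M *m invmx g^T)).
by rewrite /chart_mx !mulmxA mulVmx // !mul1mx !mulmxK ?unitmx_tr.
Qed.

End Chart.

Section ChartTopology.
Variables (R : realType) (n : nat).
Local Notation d := ((n * n.+1) %/ 2)%N.

(** Both topologies are unfolded: the quotient topology, and the topology that
    GL(n, R) inherits from the space of matrices. *)
Lemma locsym_openP (A : set (locsym R n)) : open A <->
  exists2 O : set 'M[R]_n, open O &
    forall h : GLn R n, A (locsym_class h) <-> O (\val h).
Proof.
split=> [[O oO OA]|[O oO OA]].
  exists O => // h; have OAh : O (\val h) = A (locsym_class h).
    exact: (congr1 (fun S : set (GLn R n) => S h) OA).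
  by rewrite OAh.
exists O => //; apply/seteqP; split=> h /=.
  by move=> /OA.
by move=> Ah; apply/OA.
Qed.

(** The class of A is the class of its Cholesky factor, which is continuous. *)
Lemma open_gram_class (A : set (locsym R n)) (F : 'rV[R]_d -> 'M[R]_n)
    (u : 'rV[R]_d) :
  open A -> A (gram_class (F u)) -> posdef (F u) ->
  F v @[v --> u] --> F u -> (\forall v \near u, posdef (F v)) ->
  \forall v \near u, A (gram_class (F v)).
Proof.
move=> /locsym_openP[O oO OA] AFu Fupd Fcvg Fpd.
have FF : Filter (nbhs u) := nbhs_filter u.
have OFu : O (cholesky (F u)) by rewrite -val_cholesky //; apply/OA.
have := @cvg_cholesky R _ _ FF n F _ Fupd Fcvg _ (open_nbhs_nbhs (conj oO OFu)).
move=> On; apply: (@filterS2 _ (nbhs u) FF _ _ _ _ On Fpd) => v Ov vpd.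
by apply/OA; rewrite val_cholesky.
Qed.

Lemma locsym_chart (x : locsym R n) : exists G U p,
  @orbifold_chart R (locsym R n) (@open (locsym R n)) d x G U p.
Proof.
have [[g gP] ->] := gram_class_surj x; have gU : g \in unitmx by exact: (set_mem gP).
rewrite /= {gP}.
have [e [e0 e4 eP]] := chart_radius gU.
exists (chart_group g), (chart_dom e), (fun u => gram_class (chart_mx g u)).
have domP u : chart_dom e u -> posdef (chart_mx g u).
  exact: chart_mx_posdef.
have dom_open := @open_chart_dom R n e.
split.
- exact: chart_group_finite.
(* Orthogonal matrices preserve the Frobenius norm. *)
- split=> // u _ ue [z [zU zO] <-].
  by rewrite /chart_dom /= sym_mx_act sqfrob_conj.
- by exists 0; rewrite /chart_dom /chart_mx /= linear0 ?sqfrob0 // addr0 mulmx1.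
- split=> [A oA|W oW WU].
    rewrite openE => u [ue Au].
    have dom_near : \forall v \near u, chart_dom e v.
      by apply: open_nbhs_nbhs; split.
    apply: (@filterI _ (nbhs u) (nbhs_filter u)) => //.
    apply: open_gram_class => //; first exact: domP.
      by apply: (@cvg_chart_mx R n g _ (nbhs u) (nbhs_filter u) id); exact: cvg_id.
    by apply: (@filterS _ (nbhs u) (nbhs_filter u)) dom_near => v; exact: domP.
  (* The parameter of z *m (h *m h^T) *m z^T.  The classes of points of W are
     those of the h for which some z brings this parameter into W. *)
  pose back (z : 'M[int]_n) (h : 'M[R]_n) : 'M[R]_n :=
    invmx g *m (map_mx intr z *m (h *m h^T) *m (map_mx intr z)^T) *m (invmx g)^T - 1%:M.
  have back_cvg z (h : 'M[R]_n) :
      sym_coord (back z k) @[k --> h] --> sym_coord (back z h).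
    have FF : Filter (nbhs h) := nbhs_filter h.
    have hcvg : k @[k --> h] --> h by exact: cvg_id.
    apply: cvg_sym_coord.
    apply: cvg_addmx; last exact: cvg_cst.
    apply: cvg_mulmx; last exact: cvg_cst.
    apply: cvg_mulmx; first exact: cvg_cst.
    apply: cvg_mulmx; last exact: cvg_cst.
    apply: cvg_mulmx; first exact: cvg_cst.
    by apply: cvg_mulmx => //; exact: cvg_trmx.
  apply/locsym_openP.
  exists [set h | exists2 z : 'M[int]_n, z \in unitmx & W (sym_coord (back z h))].
    rewrite openE => h [z zU Wz].
    have := back_cvg z h _ (open_nbhs_nbhs (conj oW Wz)).
    by apply: (@filterS _ (nbhs h) (nbhs_filter h)) => k Wk; exists z.
  move=> h; have hpd := posdef_gram (GLn_unit h); rewrite -gram_class_gram.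
  split=> [[u Wu /(gram_class_eq (domP _ (WU _ Wu)) hpd)[z zU hE]]|[z zU Wz]].
    exists (invmx z); first by rewrite unitmx_inv.
    suff -> : back (invmx z) (\val h) = sym_mx u by rewrite sym_mxK.
    have zV : map_mx intr (invmx z) *m map_mx intr z = 1%:M :> 'M[R]_n.
      by rewrite -map_mxM mulVmx // map_mx1.
    by rewrite /back hE (congr_mxK _ zV) congr_mxK ?mulVmx // addrC addKr.
  exists (sym_coord (back z (\val h))) => //.
  apply/esym/(gram_class_eq hpd (domP _ (WU _ Wz))); exists z => //.
  rewrite /chart_mx sym_coordK; last first.
    by rewrite /back linearB /= trmx1 !trmx_mul !trmxK !mulmxA.
  by rewrite /back addrC subrK congr_mxK // mulmxV.
- move=> u v ue ve; rewrite (gram_class_eq (domP u ue) (domP v ve)).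
  split=> [[z zU /(chart_mx_conj gU) zE]|[_ [z [zU zO] <-] ->]].
    have zO := eP _ _ _ ue ve zE; exists (sym_act_mx (conj_int g z)).
      by exists z.
    apply: (can_inj (@sym_mxK R n)); rewrite sym_mx_act.
    by apply: (addrI 1%:M); rewrite -zE mulmxDr mulmx1 mulmxDl zO.
  exists z => //; apply/(chart_mx_conj gU).
  by rewrite sym_mx_act mulmxDr mulmx1 mulmxDl zO.
Qed.

Lemma orbifold_dim_pullback (A : Type) (B : topologicalType) (f : A -> B) k :
  bijective f -> orbifold_dim R (@open B) k -> orbifold_dim R (pullback_open f) k.
Proof.
move=> [h fK hK] [[b] charts]; split; first exact: (inhabits (h b)).
move=> x; have [G [U [p [Gfin Uopen [u Uu pu] [pcont popen] pfib]]]] := charts (f x).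
exists G, U, (h \o p); split=> //.
- by exists u => //=; rewrite pu fK.
- split=> [_ [O oO ->]|W oW WU] /=.
    under [X in open X]eq_set do rewrite hK; exact: pcont.
  exists [set y | exists2 u, W u & p u = y]; first exact: popen.
  apply/funext => y; apply/propext; split=> -[w Ww pw]; exists w => //=.
    by rewrite -pw /= hK.
  by rewrite pw fK.
- move=> w v Uw Uv; rewrite -pfib //=; split=> [|->//].
  by move=> /(congr1 f); rewrite !hK.
Qed.

End ChartTopology.

(* A class g O(n) is identified with the positive definite matrix g *m g^T, and
   the topology of A_n^trop is the one transported by Phi. *)
Theorem corollary6p18 (R : realType) (n : nat) :
  exists Phi : trop_moduli R n -> locsym R n,
    [/\ forall (X : pptav R n) (b : n.-tuple X), zbasis (periods X) b ->
          exists2 g : GLn R n, \val g *m (\val g)^T = gram (pol_form X) b &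
                               Phi (tav_class X) = locsym_class g,
        bijective Phi &
        orbifold_dim R (pullback_open Phi) ((n * n.+1) %/ 2)].
Proof.
exists (@moduli_map R n); split; last first.
- apply: orbifold_dim_pullback; first exact: moduli_map_bij.
  by split; [exact: (inhabits (locsym_class (SigSub (GLn1 R n))))|exact: locsym_chart].
- exact: moduli_map_bij.
move=> X b zb; have Apd := pptav_posdef zb.
exists (insubd (SigSub (GLn1 R n) : GLn R n) (cholesky (gram (pol_form X) b))).
  by rewrite val_cholesky // choleskyP.
exact: moduli_mapE.
Qed.
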